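(* For every infinite set $D\subseteq\omega$ with $0\notin D$, there exist a bounded complexity measure $\psi$ and a nonempty closed class $A$ of decision tables from $\mathcal{M}_k^2$ such that $F^W_{\psi,A}(n)=F^\Theta_{\psi,A}(n)=H_D(n)$ for every $n\in\omega$.
   Context: Fix an integer $k\ge 2$; $\omega=\{0,1,2,\ldots\}$, $E_k=\{0,1,\ldots,k-1\}$, $E_2=\{0,1\}$. Let $P=\{f_i:i\in\omega\}$ be a set of attribute names ($f_i\ne f_j$ for $i\ne j$). $\mathcal{M}_k^2$ is the set of rectangular tables filled with numbers from $E_k$ whose columns are labeled with pairwise different attributes from $P$, whose rows are pairwise different, and in which each row is labeled with a decision from $E_2$. Tables without rows also belong to $\mathcal{M}_k^2$ and are all denoted $\Lambda$. Tables differing only by a permutation of rows are equal. $P(T)$ is the set of column attributes. $\mathcal{M}_k^2\mathcal{C}$ is the set of tables in which all rows have the same decision ($\Lambda$ included). $T(f_{i_1},\delta_1)\cdots(f_{i_m},\delta_m)$ is the table of rows of $T$ having values $\delta_1,\ldots,\delta_m$ in the columns labeled $f_{i_1},\ldots,f_{i_m}$. Operations: for $D\subseteq P(T)$, $I(D,T)$ deletes the columns labeled by $D$ and, in each group of rows coinciding on the remaining columns, keeps one row with the minimum decision; $I(P(T),T)=\Lambda$. For $\nu:E_k^{|P(T)|}\to E_2$, $J(\nu,T)$ replaces the decision of each row $\bar\delta$ by $\nu(\bar\delta)$. $[T]=\{J(\nu,I(D,T)):D\subseteq P(T),\nu:E_k^{|P(T)\setminus D|}\to E_2\}$; $[A]=\bigcup_{T\in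 A}[T]$; nonempty $A$ is a closed class if $[A]=A$. A test of $T$ is $D\subseteq P(T)$ such that any two rows with different decisions differ in a column labeled from $D$ (for $T\in\mathcal{M}_k^2\mathcal{C}$ every subset is a test). A $k$-decision tree: finite directed rooted tree with at least two nodes, root and its leaving edges unlabeled, terminal nodes labeled with decisions from $E_2$, other nodes labeled with attributes from $P$ whose leaving edges are labeled with numbers from $E_k$; $P(\Gamma)$ is the set of attributes at nodes. For a complete path $\tau=v_1,d_1,\ldots,v_m,d_m,v_{m+1}$ (root to terminal node), $F(\tau)$ is the empty word if $m=1$, else $f_{i_2}\cdots f_{i_m}$ where $v_j$ is labeled $f_{i_j}$; $T(\tau)=T$ if $m=1$, else $T(f_{i_2},\delta_2)\cdots(f_{i_m},\delta_m)$ with $d_j$ labeled $\delta_j$. For $T\ne\Lambda$, a deterministic decision tree for $T$: exactly one edge leaves the root, edges leaving any other nonterminal node have pairwise different labels, $P(\Gamma)\subseteq P(T)$, every row of $T$ lies in some $T(\tau)$, and for every complete path either $T(\tau)=\Lambda$ or all rows of $T(\tau)$ have the terminal node's decision. Let $B$ be the set of finite words over $P$ (with empty word $\lambda$). A complexity measure is $\psi:B\to\omega$ with $\psi(\alpha)=0$ iff $\alpha=\lambda$, invariant under permutation of letters, $\psi(\alpha_1)\le\psi(\alpha_1\alpha_2)\le\psi(\alpha_1)+\psi(\alpha_2)$; it is bounded if $\psi(\alpha)\ge|\alpha|$. For finite $D\subseteq P$: $\psi(\emptyset)=0$, $\psi(\{f_{i_1},\ldots,f_{i_m}\})=\psi(f_{i_1}\cdots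 f_{i_m})$. $\psi(\Gamma)=\max_\tau\psi(F(\tau))$ over complete paths. For $T\ne\Lambda$: $\psi^d(T)$ is the minimum of $\psi(\Gamma)$ over deterministic decision trees for $T$; $\Theta_\psi(T)$ the minimum of $\psi(D)$ over tests $D$; $W_\psi(T)=\psi(P(T))$; all are $0$ on $\Lambda$. $F^W_{\psi,A}(n)=\max\{\psi^d(T):T\in A,W_\psi(T)\le n\}$, $F^\Theta_{\psi,A}(n)=\max\{\psi^d(T):T\in A,\Theta_\psi(T)\le n\}$. For infinite $D=\{n_i:i\in\omega\}\subseteq\omega$ with $n_i<n_{i+1}$: $H_D(n)=0$ if $n<n_0$ and $H_D(n)=n_i$ if $n_i\le n<n_{i+1}$. *)

(* Defs.v *)
From HB Require Import structures.
From mathcomp Require Import all_boot all_order finmap.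
From mathcomp Require Import boolp classical_sets functions cardinality.

Set Implicit Arguments.
Unset Strict Implicit.
Unset Printing Implicit Defensive.

Local Open Scope classical_set_scope.
Local Open Scope fset_scope.
Local Open Scope nat_scope.

(* The attribute name f_i is represented by its index i. *)
Notation attr := nat.

Section Tables.
Variable k : nat.

Notation row := (seq 'I_k).

(* Columns are ordered, rows are not. The value Lambda is the only table without
   rows, and it has no columns; a nonempty table has at least one column, since
   deleting all the columns of a table gives Lambda. *)
Definition is_table (t : seq attr * {fset row * 'I_2}) : bool :=
  [&& uniq t.1, uniq [seq p.1 | p <- t.2],
      all (fun p => size p.1 == size t.1) t.2
    & (t.1 == [::]) == (t.2 == fset0)].

Record table := Table {
  table_val :> seq attr * {fset row * 'I_2};
  tableP : is_table table_val }.

HB.instance Definition _ := [isSub for table_val].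
HB.instance Definition _ := [Choice of table by <:].

Implicit Type T : table.

Definition cols T : seq attr := (table_val T).1.
Definition rows T : {fset row * 'I_2} := (table_val T).2.
Definition attrs T : {fset attr} := [fset f in cols T].

Lemma Lambda_subproof : is_table ([::], fset0).
Proof. by rewrite /is_table /= !eqxx. Qed.

Definition Lambda : table := Table Lambda_subproof.

(* Data with columns but no rows, or with rows but no columns, become Lambda;
   [subtable_rowsE], [opI_rowsE], [opI_full] and [opJ_rowsE] show that nothing
   else is lost. *)
Definition mk_table (c : seq attr) (R : {fset row * 'I_2}) : table :=
  insubd Lambda (c, R).

(* The value of the row r of T in the column f (None if f is not in P(T)). *)
Definition value T (r : row) (f : attr) : option 'I_k := onth r (index f (cols T)).

Definition subtable T (w : seq (attr * 'I_k)) : table :=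
  mk_table (cols T)
    [fset p in rows T | all (fun fd => value T p.1 fd.1 == Some fd.2) w].

Definition del (D : {fset attr}) T (r : row) : row :=
  mask [seq f \notin D | f <- cols T] r.

Definition opI (D : {fset attr}) T : table :=
  mk_table [seq f <- cols T | f \notin D]
    [fset (del D T p.1,
           \big[Order.min/ord_max]_(q <- rows T | del D T q.1 == del D T p.1) q.2)
    | p in rows T].

(* Only the values of nu on the words of length |P(T)| matter. *)
Definition opJ (nu : row -> 'I_2) T : table :=
  mk_table (cols T) [fset (p.1, nu p.1) | p in rows T].

Definition tclosure1 T : set table :=
  [set opJ Dnu.2 (opI Dnu.1 T) |
     Dnu in [set Dnu : {fset attr} * (row -> 'I_2) | Dnu.1 `<=` attrs T]].

Definition tclosure (A : set table) : set table :=
  (\bigcup_(T in A) tclosure1 T)%classic.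

Definition closed_class (A : set table) : Prop :=
  (A !=set0)%classic /\ tclosure A = A.

Definition is_test T (D : {fset attr}) : Prop :=
  D `<=` attrs T /\
  {in rows T &, forall p q, p.2 != q.2 ->
     exists2 f, f \in D & value T p.1 f != value T q.1 f}.

(* [Query f a v es] is a node labeled with f; its leaving edges are the pairs
   (label, target) in (a, v) :: es, so there is at least one. *)
Inductive node : Type :=
| Leaf of 'I_2
| Query of attr & 'I_k & node & seq ('I_k * node).

(* The children of the root; the edges leaving the root are not labeled. *)
Record dtree := DTree { first_child : node; other_children : seq node }.

Definition children (G : dtree) : seq node := first_child G :: other_children G.

(* The pairs (attribute, value) along the paths from v to a terminal node,
   together with the decision at this node. *)
Fixpoint node_paths (v : node) : seq (seq (attr * 'I_k) * 'I_2) :=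
  match v with
  | Leaf d => [:: ([::], d)]
  | Query f a v' es =>
      [seq ((f, a) :: p.1, p.2) | p <- node_paths v'] ++
      flatten [seq [seq ((f, e.1) :: p.1, p.2) | p <- node_paths e.2] | e <- es]
  end.

Definition paths (G : dtree) : seq (seq (attr * 'I_k) * 'I_2) :=
  flatten [seq node_paths v | v <- children G].

Fixpoint node_attrs (v : node) : seq attr :=
  match v with
  | Leaf _ => [::]
  | Query f _ v' es =>
      f :: node_attrs v' ++ flatten [seq node_attrs e.2 | e <- es]
  end.

Definition tree_attrs (G : dtree) : {fset attr} :=
  [fset f in flatten [seq node_attrs v | v <- children G]].

Fixpoint node_deterministic (v : node) : bool :=
  match v with
  | Leaf _ => true
  | Query _ a v' es =>
      [&& uniq (a :: [seq e.1 | e <- es]), node_deterministic v'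
        & all (fun e => node_deterministic e.2) es]
  end.

Definition is_det_tree T (G : dtree) : Prop :=
  [/\ other_children G = [::] /\ node_deterministic (first_child G),
      tree_attrs G `<=` attrs T,
      {in rows T, forall r,
         exists2 p, p \in paths G & r \in rows (subtable T p.1)}
    & {in paths G, forall p, subtable T p.1 = Lambda \/
         {in rows (subtable T p.1), forall r, r.2 = p.2}}].

End Tables.

Definition complexity_measure (psi : seq attr -> nat) : Prop :=
  [/\ forall a, psi a = 0 <-> a = [::],
      forall a b, perm_eq a b -> psi a = psi b
    & forall a b, psi a <= psi (a ++ b) <= psi a + psi b].

Definition bounded (psi : seq attr -> nat) : Prop := forall a, size a <= psi a.

Definition is_min (S : set nat) (m : nat) : Prop := S m /\ forall n, S n -> m <= n.
Definition is_max (S : set nat) (m : nat) : Prop := S m /\ forall n, S n -> n <= m.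

Definition least (S : set nat) : nat := xget 0 (is_min S).

Section Complexity.
Variables (k : nat) (psi : seq attr -> nat).
Implicit Type T : table k.

Definition psi_set (D : {fset attr}) : nat := psi (enum_fset D).

Definition psi_tree (G : dtree k) : nat :=
  \max_(p <- paths G) psi [seq fd.1 | fd <- p.1].

(* The minima are attained: see [psi_dP] and [ThetaP]. *)
Definition psi_d T : nat :=
  if T == Lambda k then 0 else least [set psi_tree G | G in is_det_tree T]%classic.

Definition Theta T : nat :=
  if T == Lambda k then 0 else least [set psi_set D | D in is_test T]%classic.

Definition W T : nat := if T == Lambda k then 0 else psi_set (attrs T).

(* [m] is the value at n of F^W, resp. F^Theta; these are partial functions,
   undefined where the maximum does not exist. *)
Definition FW_is (A : set (table k)) (n m : nat) : Prop :=
  is_max [set psi_d T | T in [set T | A T /\ W T <= n]]%classic m.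

Definition FTheta_is (A : set (table k)) (n m : nat) : Prop :=
  is_max [set psi_d T | T in [set T | A T /\ Theta T <= n]]%classic m.

End Complexity.

Definition increasing_enum (D : set nat) (e : nat -> nat) : Prop :=
  {homo e : i j / i < j} /\ range e = D.

(* The step function H_D; it is well defined by [increasing_enum_exists] and
   [Hstep_spec]. *)
Definition Hstep (D : set nat) (n : nat) : nat :=
  xget 0 [set h | exists e, increasing_enum D e /\
    ((n < e 0 /\ h = 0) \/ exists i, e i <= n < e i.+1 /\ h = e i)]%classic.

Import Order.Theory.

Section TableFacts.
Variable k : nat.
Notation row := (seq 'I_k).
Implicit Types (T : table k) (R : {fset row * 'I_2}).

Lemma uniq_map_inj (A B : eqType) (f : A -> B) s :
  uniq (map f s) -> {in s &, injective f}.
Proof.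
elim: s => //= a s IH /andP[aN Us] x y; rewrite !inE.
move=> /predU1P[->|xs] /predU1P[->|ys] // e; last exact: IH.
- by case/negP: aN; rewrite e map_f.
- by case/negP: aN; rewrite -e map_f.
Qed.

Lemma mk_tableE c R : is_table (c, R) -> table_val (mk_table c R) = (c, R).
Proof. by move=> h; rewrite /mk_table -[LHS]/(val _) val_insubd h. Qed.

Lemma mk_table_rowsE c R : uniq c -> c != [::] ->
  {in R &, injective (fun p : row * 'I_2 => p.1)} ->
  {in R, forall p, size p.1 = size c} ->
  rows (mk_table c R) = R /\ (R != fset0 -> cols (mk_table c R) = c).
Proof.
move=> Uc cN0 injR sizeR; have [R0|RN0] := eqVneq R fset0; last first.
  have h : is_table (c, R).
    rewrite /is_table /= Uc (negbTE cN0) (negbTE RN0) eqxx andbT /=.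
    rewrite map_inj_in_uniq ?fset_uniq //=.
    by apply/allP => p /sizeR ->.
  by rewrite /rows /cols mk_tableE.
split=> //; rewrite R0 /rows /mk_table /insubd insubF //.
by rewrite /is_table /= (negbTE cN0) eqxx andbF.
Qed.

Lemma rows_inj T : {in rows T &, injective (fun p : row * 'I_2 => p.1)}.
Proof.
by have /and4P[_ /uniq_map_inj] := tableP T.
Qed.

Lemma rows_size T : {in rows T, forall p, size p.1 = size (cols T)}.
Proof.
by move=> p pT; have /and4P[_ _ /allP/(_ p pT)/eqP] := tableP T.
Qed.

Lemma cols_uniq T : uniq (cols T).
Proof. by have /and4P[] := tableP T. Qed.

Lemma cols_nil T : (cols T == [::]) = (T == Lambda k).
Proof.
case: T => -[c R] h; case/and4P: (h) => /= _ _ _ /eqP e.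
by rewrite -val_eqE /= xpair_eqE /cols /= -e andbb.
Qed.

Lemma rows_nil T : (rows T == fset0) = (T == Lambda k).
Proof.
case: T => -[c R] h; case/and4P: (h) => /= _ _ _ /eqP e.
by rewrite -val_eqE /= xpair_eqE /rows /= e andbb.
Qed.

Lemma subtable_rowsE T w : rows (subtable T w) =
  [fset p in rows T | all (fun fd => value T p.1 fd.1 == Some fd.2) w].
Proof.
have [/eqP|cN0] := boolP (cols T == [::]).
  move=> /eqP; rewrite cols_nil => /eqP ->.
  have e : [fset p in rows (Lambda k) |
      all (fun fd => value (Lambda k) p.1 fd.1 == Some fd.2) w] = fset0.
    by apply/fsetP => x; rewrite !inE.
  by rewrite /subtable e /rows mk_tableE // /is_table /= !eqxx.
apply: (proj1 (mk_table_rowsE (cols_uniq T) cN0 _ _)).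
- by move=> p q; rewrite !inE /= => /andP[pT _] /andP[qT _] e; exact: (rows_inj pT qT e).
- by move=> p; rewrite !inE /= => /andP[pT _]; exact: (rows_size pT).
Qed.

Lemma opJ_rowsE nu T : cols (opJ nu T) = cols T /\
  rows (opJ nu T) = [fset (p.1, nu p.1) | p in rows T].
Proof.
have [/eqP|cN0] := boolP (cols T == [::]).
  move=> /eqP; rewrite cols_nil => /eqP ->.
  have e : [fset (p.1, nu p.1) | p in rows (Lambda k)] = fset0.
    by apply/fsetP => x; rewrite inE; apply/imfsetP => -[].
  by rewrite /opJ e /cols /rows /= mk_tableE // /is_table /= !eqxx.
have [| |-> h] := @mk_table_rowsE (cols T)
    [fset (p.1, nu p.1) | p in rows T] (cols_uniq T) cN0.
- by move=> _ _ /imfsetP[p /= _ ->] /imfsetP[q /= _ ->] /= ->.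
- by move=> _ /imfsetP[p /= pT ->]; exact: (rows_size pT).
split=> //; apply: h; move: cN0; rewrite cols_nil -rows_nil.
by case/fset0Pn => p pT; apply/fset0Pn; exists (p.1, nu p.1); apply: in_imfset.
Qed.

Lemma opI_full D T : attrs T `<=` D -> opI D T = Lambda k.
Proof.
move=> /fsubsetP sTD; have e : [seq f <- cols T | f \notin D] = [::].
  apply/eqP; rewrite -(negbK (_ == _)) -has_filter; apply/hasPn => f fT.
  by rewrite negbK; apply: sTD; rewrite inE.
have [/eqP|TN0] := boolP (rows T == fset0).
  move=> /eqP; rewrite rows_nil => /eqP T0.
  apply/val_inj; rewrite /= /opI e mk_tableE.
  - by congr pair; apply/fsetP=> x; rewrite inE T0; apply/imfsetP => -[].
  - rewrite /is_table /= eqxx /=.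
    suff -> : [fset (del D T p.1,
           \big[Order.min/ord_max]_(q <- rows T | del D T q.1 == del D T p.1) q.2)
    | p in rows T] = fset0 by rewrite !eqxx.
    by apply/fsetP=> x; rewrite inE T0; apply/imfsetP => -[].
rewrite /opI e /mk_table /insubd insubF // /is_table /= eqxx.
case/fset0Pn: TN0 => p pT.
set S := imfset _ _ _; suff /negbTE-> : S != fset0 by rewrite !andbF.
by apply/fset0Pn; eexists; apply: (in_imfset _ _ pT).
Qed.

(* The decision that [opI] gives to a row is the minimum over its group. *)
Lemma min_decP (s : seq (row * 'I_2)) (P : pred (row * 'I_2)) p :
  p \in s -> P p ->
  let m := \big[Order.min/ord_max]_(q <- s | P q) q.2 in
  (exists2 q, q \in s & P q /\ q.2 = m) /\
  (forall q, q \in s -> P q -> (m <= q.2)%N).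
Proof.
move=> ps Pp m.
have lb q : q \in s -> P q -> (m <= q.2)%N.
  rewrite /m; elim: s {m ps} => //= a s IH; rewrite inE big_cons => /predU1P[->|qs] Pq.
    by rewrite Pq minEle; case: ifP => //; rewrite leEord => /negbT; rewrite -ltnNge => /ltnW.
  case: ifP => _; last exact: IH.
  rewrite minEle leEord; case: ifP => [|_]; last exact: IH.
  by move=> h; apply: (leq_trans h); apply: IH.
split=> //; have : m = ord_max \/ exists2 q, q \in s & P q /\ q.2 = m.
  rewrite /m; elim: s {m ps lb} => [|a s IH]; first by left; rewrite big_nil.
  rewrite big_cons; case: ifP => Pa; last first.
    by case: IH => [|[q qs h]]; [left|right; exists q; rewrite // inE qs orbT].
  rewrite minEle; case: ifP => _; first by right; exists a; rewrite ?inE ?eqxx.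
  by case: IH => [|[q qs h]]; [left|right; exists q; rewrite // inE qs orbT].
case=> // mm; exists p => //; split=> //; apply/val_inj/eqP => /=.
by rewrite eqn_leq lb // andbT mm -ltnS ltn_ord.
Qed.

Lemma opI_rowsE D T : ~~ (attrs T `<=` D) ->
  cols (opI D T) = [seq f <- cols T | f \notin D] /\
  rows (opI D T) = [fset (del D T p.1,
     \big[Order.min/ord_max]_(q <- rows T | del D T q.1 == del D T p.1) q.2)
    | p in rows T].
Proof.
move=> ND.
have cN0 : [seq f <- cols T | f \notin D] != [::].
  rewrite -has_filter; apply: contraNT ND => /hasPn h.
  by apply/fsubsetP => f; rewrite inE => /h; rewrite negbK.
set R := [fset _ | p in _].
have TN0 : T != Lambda k.
  by apply: contraNneq cN0 => ->.
have [| |rE cE] := @mk_table_rowsE [seq f <- cols T | f \notin D] R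
  (filter_uniq _ (cols_uniq T)) cN0.
- by move=> _ _ /imfsetP[p /= _ ->] /imfsetP[q /= _ ->] /= ->.
- move=> _ /imfsetP[p /= pT ->] /=.
  by rewrite /del filter_mask !size_mask // size_map // (rows_size pT).
split=> //; apply: cE; move: TN0; rewrite -rows_nil.
by case/fset0Pn => p pT; apply/fset0Pn; eexists; apply: (in_imfset _ _ pT).
Qed.
End TableFacts.

Lemma increasing_enum_exists (D : set nat) : infinite_set D ->
  exists e, increasing_enum D e.
Proof.
move=> Dinf.
have nxt n : exists m, (n < m) && `[< D m >].
  apply: contrapT => h; apply: Dinf; apply: (@sub_finite_set _ _ `I_n.+1).
    move=> m Dm /=; rewrite ltnS leqNgt; apply/negP => nm; apply: h; exists m.
    by rewrite nm; apply/asboolP.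
  exact: finite_II.
have [m0 Dm0] : exists m, `[< D m >].
  by have [m /andP[_ ?]] := nxt 0; exists m.
have ex0 : exists m, `[< D m >] by exists m0.
pose e := fix e i := if i is j.+1 then ex_minn (nxt (e j)) else ex_minn ex0.
have eS i : e i < e i.+1 by rewrite /=; case: ex_minnP => m /andP[].
have einc : {homo e : i j / i < j} by apply: homo_ltn => //; apply: ltn_trans.
exists e; split=> //; apply/seteqP; split=> [_ [i _ <-]|m Dm].
  case: i => [|i] /=; case: ex_minnP => m; first by move=> /asboolP.
  by case/andP=> _ /asboolP.
have ege i : i <= e i by elim: i => // i IH; apply: leq_ltn_trans (eS i).
have [i []] : exists i, e i <= m /\ m < e i.+1.
  have h0 : e 0 <= m by rewrite /=; case: ex_minnP => x _; apply; apply/asboolP.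
  have exi : exists i, e i <= m by exists 0.
  have ub i : e i <= m -> i <= m by apply: leq_trans.
  case: (ex_maxnP exi ub) => i hi hmax; exists i; split=> //.
  by rewrite ltnNge; apply/negP => /hmax; rewrite ltnn.
rewrite leq_eqVlt => /predU1P[<-|lt]; first by exists i.
rewrite [e i.+1]/=; case: ex_minnP => x _ /(_ m).
rewrite lt /= => h; rewrite ltnNge h //; exact/asboolP.
Qed.

Lemma Hstep_spec (D : set nat) e : increasing_enum D e ->
  (forall n, n < e 0 -> Hstep D n = 0) /\
  (forall n i, e i <= n < e i.+1 -> Hstep D n = e i).
Proof.
move=> [einc eD].
have mono (f : nat -> nat) i j : {homo f : i j / i < j} -> f i < f j.+1 -> i <= j.
  move=> inc; move=> lt; rewrite leqNgt; apply/negP; rewrite leq_eqVlt.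
  case/predU1P => [ji|/inc ji]; first by rewrite ji ltnn in lt.
  by move: (ltn_trans lt ji); rewrite ltnn.
have main n h : ((n < e 0 /\ h = 0) \/ exists i, e i <= n < e i.+1 /\ h = e i) ->
    Hstep D n = h.
  move=> hn; apply: xget_unique; first by exists e.
  move=> h' [e' [[e'inc e'D] h'n]].
  have De i : exists j, e i = e' j.
    have : D (e i) by rewrite -eD; exists i.
    by rewrite -e'D => -[j _ <-]; exists j.
  have De' i : exists j, e' i = e j.
    have : D (e' i) by rewrite -e'D; exists i.
    by rewrite -eD => -[j _ <-]; exists j.
  have le0 (f : nat -> nat) i : {homo f : i j / i < j} -> f 0 <= f i.
    by case: i => // i fi; apply/ltnW/fi.
  have lei (f : nat -> nat) i j : {homo f : i j / i < j} -> i <= j -> f i <= f j.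
    by move=> fi; rewrite leq_eqVlt => /predU1P[->//|/fi/ltnW].
  case: hn => [[n0 ->]|[i [/andP[in_ ni] ->]]];
  case: h'n => [[n0' ->]//|[j [/andP[jn nj] ->]]].
  - have [l el] := De' j; have := le0 e l einc.
    by rewrite -el leqNgt (leq_ltn_trans jn).
  - have [l el] := De i; have := le0 e' l e'inc.
    by rewrite -el leqNgt (leq_ltn_trans in_).
  - have [l el] := De' j; have [l' el'] := De i.
    apply/eqP; rewrite eqn_leq; apply/andP; split.
      by rewrite el; apply: lei => //; apply: (mono e) => //; rewrite -el (leq_ltn_trans jn).
    by rewrite el'; apply: lei => //; apply: (mono e') => //; rewrite -el' (leq_ltn_trans in_).
by split=> [n n0|n i ni]; apply: main; [left|right; exists i].
Qed.

Section FullTree.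

Lemma onth_some (A : Type) (x0 : A) s i : i < size s -> onth s i = Some (nth x0 s i).
Proof. by rewrite -onthTE -(odflt_onth x0); case: onth. Qed.

Variable k : nat.
Implicit Types (T : table k).

Lemma attrs_is_test T : is_test T (attrs T).
Proof.
split=> // p q pT qT pq.
have npq : p.1 != q.1.
  by apply: contraNneq pq => e; rewrite (rows_inj pT qT e).
have e1 := rows_size pT; have e2 := rows_size qT.
have [i ilt ne] : exists2 i, i < size (cols T) & onth p.1 i != onth q.1 i.
  apply: contrapT => h; move/eqP: npq; apply.
  apply: eq_from_onth => i.
  have [lt|ge] := ltnP i (size (cols T)).
    by apply/eqP/negPn/negP => ?; apply: h; exists i.
  by rewrite !onth_default ?e1 ?e2.
exists (nth 0 (cols T) i); first by rewrite inE mem_nth.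
by rewrite /value index_uniq ?cols_uniq.
Qed.

Variables (a0 : 'I_k) (es : seq 'I_k).
Hypothesis enumE : enum 'I_k = a0 :: es.
Variable dec : seq (attr * 'I_k) -> 'I_2.

Fixpoint full (c : seq attr) (acc : seq (attr * 'I_k)) : node k :=
  if c is f :: c' then
    Query f a0 (full c' (rcons acc (f, a0)))
      [seq (a, full c' (rcons acc (f, a))) | a <- es]
  else Leaf k (dec acc).

Lemma full_pathsS f c acc : node_paths (full (f :: c) acc) =
  flatten [seq [seq ((f, a) :: p.1, p.2) | p <- node_paths (full c (rcons acc (f, a)))]
    | a <- enum 'I_k].
Proof. by rewrite enumE /= -map_comp. Qed.

Lemma full_paths c acc p : reflect
  (exists2 v, size v = size c & p = (zip c v, dec (acc ++ zip c v)))
  (p \in node_paths (full c acc)).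
Proof.
elim: c acc p => [|f c IH] acc p.
  rewrite /= inE; apply: (iffP eqP) => [->|[[|//] _ ->]]; last by rewrite cats0.
  by exists [::]; rewrite //= cats0.
rewrite full_pathsS; apply: (iffP flatten_mapP) => [[a _ /mapP[q]]|].
  case/IH => v sv -> ->; exists (a :: v); rewrite /= ?sv //.
  by rewrite cat_rcons.
case=> -[//|a v] [sv] ->; exists a; first by rewrite mem_enum.
apply/mapP; exists (zip c v, dec (rcons acc (f, a) ++ zip c v)).
  by apply/IH; exists v.
by rewrite /= cat_rcons.
Qed.

Lemma full_det c acc : node_deterministic (full c acc).
Proof.
elim: c acc => //= f c IH acc; rewrite IH -map_comp map_id_in //= -cons_uniq.
rewrite -enumE enum_uniq /=.
by rewrite all_map; apply/allP => a _ /=.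
Qed.

Lemma full_attrs c acc : {subset node_attrs (full c acc) <= c}.
Proof.
elim: c acc => //= f c IH acc x; rewrite !inE mem_cat => /or3P[->//|/IH->|].
  by rewrite orbT.
rewrite -map_comp => /flatten_mapP[a _ /= /IH ->]; by rewrite orbT.
Qed.
End FullTree.

Lemma is_det_tree_exists k (T : table k) : T <> Lambda k ->
  exists G, is_det_tree T G.
Proof.
move=> TN.
have [r0 r0T] : exists r, r \in rows T.
  by apply/fset0Pn; rewrite rows_nil; apply/eqP.
have [a0 [es enumE]] : exists a es, enum 'I_k = a :: es.
  have : enum 'I_k != [::].
    have /eqP := TN; rewrite -cols_nil.
    have := rows_size r0T; case: (r0.1) => [|a r] /=; first by case: (cols T).
    by move=> _ _; apply/eqP => e; have := mem_enum 'I_k a; rewrite e.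
  by case: (enum _) => // a s; exists a, s.
pose dec w := nth ord0 [seq r.2 | r <- rows (subtable T w)] 0.
pose G := DTree (full a0 es dec (cols T) [::]) [::].
have P p : p \in paths G -> exists2 v, size v = size (cols T) &
    p = (zip (cols T) v, dec (zip (cols T) v)).
  by rewrite /paths /= cats0 => /(full_paths enumE).
have sub v r : size v = size (cols T) ->
    (r \in rows (subtable T (zip (cols T) v))) = (r \in rows T) && (r.1 == v).
  move=> sv; rewrite subtable_rowsE !inE /=; case rT: (r \in rows T) => //=.
  have sr := rows_size rT.
  apply/allP/eqP => [h|<-].
    apply: (@eq_from_nth _ a0); rewrite ?sr ?sv // => i lti.
    have /h /= : (nth 0 (cols T) i, nth a0 v i) \in zip (cols T) v.
      by rewrite -nth_zip // mem_nth // size_zip sv minnn.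
    rewrite /value index_uniq ?cols_uniq // => /eqP.
    by rewrite (onth_some a0) ?sr // => -[].
  move=> [f d] /(nthP (0, a0))[i]; rewrite size_zip sr minnn => lti.
  rewrite nth_zip ?sr // => -[<- <-] /=.
  by rewrite /value index_uniq ?cols_uniq // (onth_some a0) ?sr.
exists G; split.
- by split=> //; apply: full_det enumE _ _ _.
- rewrite /tree_attrs /attrs /= cats0; apply/fsubsetP => f; rewrite !inE; exact: full_attrs.
- move=> r rT; exists (zip (cols T) r.1, dec (zip (cols T) r.1)).
    rewrite /paths /= cats0; apply/(full_paths enumE); exists r.1 => //.
    exact: rows_size.
  by rewrite /= sub ?rT ?eqxx // (rows_size rT).
- move=> p /P[v sv ->] /=; right=> r rS.
  have /andP[rT /eqP rv] : (r \in rows T) && (r.1 == v) by rewrite -sub.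
  rewrite /dec; case E: (enum_fset (rows (subtable T (zip (cols T) v)))) => [|q s].
    by have := rS; rewrite -[r \in _]/(r \in enum_fset _) E.
  have : q \in rows (subtable T (zip (cols T) v)).
    by rewrite -[q \in _]/(q \in enum_fset _) E inE eqxx.
  rewrite sub // => /andP[qT /eqP qv] /=.
  by rewrite (rows_inj rT qT) //= rv qv.
Qed.

Lemma leastP (S : set nat) : (S !=set0)%classic -> is_min S (least S).
Proof.
move=> [n Sn]; apply: xgetPex.
have ex : exists n, `[< S n >] by exists n; apply/asboolP.
case: (ex_minnP ex) => m /asboolP Sm hm; exists m; split=> // x Sx.
by apply: hm; apply/asboolP.
Qed.

Lemma psi_dP k psi (T : table k) : T <> Lambda k ->
  is_min [set psi_tree psi G | G in is_det_tree T]%classic (psi_d psi T).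
Proof.
move=> TN; rewrite /psi_d; move/eqP/negbTE: (TN) => ->; apply: leastP.
by have [G hG] := is_det_tree_exists TN; exists (psi_tree psi G); exists G.
Qed.

Lemma ThetaP k psi (T : table k) : T <> Lambda k ->
  is_min [set psi_set psi D | D in is_test T]%classic (Theta psi T).
Proof.
move=> TN; rewrite /Theta; move/eqP/negbTE: (TN) => ->; apply: leastP.
by exists (psi_set psi (attrs T)), (attrs T) => //; apply: attrs_is_test.
Qed.

(* Main.v *)
(** Give the attribute f_i the weight n_i, let psi be the total weight of a word
    and let A consist of the tables with at most one column.  Such a table either
    has constant decisions and depth 0, or has a single column f_i, in which case
    its depth, its weight W and its smallest test all weigh n_i. *)
Require Import Defs.
From mathcomp Require Import all_boot all_order finmap.
From mathcomp Require Import boolp classical_sets functions cardinality.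

Set Implicit Arguments.
Unset Strict Implicit.
Unset Printing Implicit Defensive.

(** * Increasing sequences and the step function *)

Section IncreasingSequences.
Variable e : nat -> nat.
Hypothesis e_inc : {homo e : i j / i < j}.

Lemma homo_ltn_leq : {homo e : i j / i <= j}.
Proof. by move=> i j; rewrite leq_eqVlt => /predU1P[->//|/e_inc/ltnW]. Qed.

Lemma homo_ltn_bracket n : e 0 <= n -> exists i, e i <= n < e i.+1.
Proof.
move=> e0n.
(* Since [i <= e i], only indices up to [n] satisfy [e i <= n]; the largest of them is the one
   sought. *)
have ge_id i : i <= e i by elim: i => // i IH; apply: leq_ltn_trans (e_inc (ltnSn i)).
have bnd i : e i <= n -> i <= n by apply: leq_trans.
have ex : exists i, e i <= n by exists 0.
case: (ex_maxnP ex bnd) => i ein imax; exists i; rewrite ein ltnNge.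
by apply/negP => /imax; rewrite ltnn.
Qed.

(** If [n] lies between [e j] and [e j.+1], then [j < i] would force [e j.+1 <= e i <= n]; hence
    [i <= j]. *)
Lemma Hstep_ge (D : set nat) n i : range e = D -> e i <= n -> e i <= Hstep D n.
Proof.
move=> eD ein; have [_ spec] := Hstep_spec (conj e_inc eD).
have [j jn] := homo_ltn_bracket (leq_trans (homo_ltn_leq (leq0n i)) ein).
rewrite (spec _ _ jn); apply: homo_ltn_leq; rewrite leqNgt; apply/negP => ji.
have /andP[_] := jn; rewrite ltnNge => /negP; apply.
exact: leq_trans (homo_ltn_leq ji) ein.
Qed.

End IncreasingSequences.

(** * The total weight of a word as a bounded complexity measure *)

Section Weight.
Variable e : nat -> nat.

Definition weight (a : seq attr) : nat := \sum_(f <- a) e f.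

Lemma weight_ge_mem f a : f \in a -> e f <= weight a.
Proof. by move=> fa; rewrite /weight (big_rem f) //= leq_addr. Qed.

Lemma psi_set_weight1 f : psi_set weight [fset f]%fset = e f.
Proof. by rewrite /psi_set /weight big_seq_fset1. Qed.

Hypothesis e_gt0 : forall i, 0 < e i.

Lemma weight_bounded : bounded weight.
Proof.
by move=> a; rewrite /weight -sum1_size; apply: leq_sum.
Qed.

Lemma weight_complexity : complexity_measure weight.
Proof.
split=> [a|a b ab|a b]; last by rewrite /weight big_cat /= leqnn leq_addr.
- split=> [a0|->]; last exact: big_nil.
  by apply: size0nil; apply/eqP; rewrite -leqn0 -a0 weight_bounded.
- exact: perm_big.
Qed.

End Weight.

(** * Decision tables: closed classes with a bounded number of columns *)

Section Tables.
Variable k : nat.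
Implicit Types T : table k.

Lemma cols_Lambda : cols (Lambda k) = [::].
Proof. by []. Qed.

Lemma psi_d_Lambda psi : psi_d psi (Lambda k) = 0.
Proof. by rewrite /psi_d eqxx. Qed.

(** The set of all columns is itself a test. This lets one upper bound in terms of [Theta] and one
    witness in terms of [W] serve both functions. *)
Lemma Theta_le_W psi T : Theta psi T <= W psi T.
Proof.
have [->|/eqP TN] := eqVneq T (Lambda k); first by rewrite /Theta eqxx.
have [_] := ThetaP psi TN; rewrite /W; move/eqP/negbTE: (TN) => ->; apply.
by exists (attrs T) => //; apply: attrs_is_test.
Qed.

(** A total function is needed as an argument of [opJ]; off the rows of [T] it takes the default
    [ord0]. *)
Definition decision T (r : seq 'I_k) : 'I_2 :=
  nth ord0 [seq p.2 | p <- rows T] (index r [seq p.1 | p <- rows T]).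

Lemma decisionE T p : p \in rows T -> decision T p.1 = p.2.
Proof.
move=> pT; have r_in : p.1 \in [seq q.1 | q <- rows T] by apply: map_f.
have lt_idx : index p.1 [seq q.1 | q <- rows T] < size (rows T).
  by rewrite -(size_map (fun q => q.1)) index_mem.
rewrite /decision (nth_map p) //; congr (_.2).
apply: (@rows_inj _ T) => //; first exact: mem_nth.
by rewrite -(nth_map p p.1) // nth_index.
Qed.

Lemma del0E T p : p \in rows T -> del fset0 T p.1 = p.1.
Proof.
move=> pT.
have maskE (s : seq attr) : [seq f \notin fset0 | f <- s] = nseq (size s) true.
  by elim: s => //= f s ->.
by rewrite /del maskE mask_true // (rows_size pT).
Qed.

(** Deleting no column keeps every row, and [opJ] overwrites whatever minimum [opI] computed with
    the original decision. So every table belongs to its own closure. *)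
Lemma opJ_decision T : opJ (decision T) (opI fset0 T) = T.
Proof.
have [->|TN] := eqVneq T (Lambda k).
  have -> : opI fset0 (Lambda k) = Lambda k.
    by apply: opI_full; apply/fsubsetP => f; rewrite /attrs cols_Lambda !inE.
  apply/eqP; rewrite -cols_nil; have [-> _] := opJ_rowsE (decision (Lambda k)) (Lambda k).
  by rewrite cols_nil.
have ND : ~~ (attrs T `<=` fset0)%fset.
  apply: contra TN; rewrite fsubset0 => /eqP T0; rewrite -cols_nil.
  case cT: (cols T) => [//|f c]; have : f \in attrs T by rewrite inE cT inE eqxx.
  by rewrite T0 inE.
have [cJ rJ] := opJ_rowsE (decision T) (opI fset0 T).
have [cI rI] := opI_rowsE ND.
have cE : cols (opJ (decision T) (opI fset0 T)) = cols T.
  by rewrite cJ cI; apply/all_filterP/allP => f _; rewrite inE.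
suff rE : rows (opJ (decision T) (opI fset0 T)) = rows T.
  by apply/val_inj; rewrite [LHS]surjective_pairing [RHS]surjective_pairing;
     congr pair.
rewrite rJ rI; apply/fsetP => q; apply/imfsetP/idP => /=.
  case=> _ /imfsetP[p /= pT ->] -> /=.
  by rewrite del0E // decisionE // -surjective_pairing.
move=> qT; eexists; first by apply: in_imfset; exact: qT.
by rewrite /= del0E // decisionE // -surjective_pairing.
Qed.

Lemma sub_tclosure (A : set (table k)) : (A `<=` tclosure A)%classic.
Proof.
move=> T AT; exists T => //; exists (fset0, decision T); first exact: fsub0set.
exact: opJ_decision.
Qed.

Lemma size_cols_opI D T : size (cols (opI D T)) <= size (cols T).
Proof.
have [sub|/opI_rowsE[-> _]] := boolP (attrs T `<=` D)%fset.
  by rewrite opI_full // cols_Lambda.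
by rewrite size_filter count_size.
Qed.

(** Neither operation ever adds a column. *)
Lemma narrow_closed_class m :
  closed_class [set T : table k | size (cols T) <= m]%classic.
Proof.
split.
  by exists (Lambda k).
apply/seteqP; split; last exact: sub_tclosure.
move=> _ [T /= Tm] [[D nu] _ <-] /=; have [-> _] := opJ_rowsE nu (opI D T).
exact: leq_trans (size_cols_opI D T) Tm.
Qed.

(** * Depth and tests under constant and nonconstant decisions *)

Lemma psi_d_le psi T G : is_det_tree T G -> T <> Lambda k ->
  psi_d psi T <= psi_tree psi G.
Proof. by move=> TG /(psi_dP psi)[_]; apply; exists G. Qed.

Definition constant_decision T := exists d, {in rows T, forall p, p.2 = d}.

(** A single leaf suffices, and its only path queries nothing. *)
Lemma psi_d_constant psi T : psi [::] = 0 -> constant_decision T -> psi_d psi T = 0.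
Proof.
move=> psi0 [d Td]; have [->|/eqP TN] := eqVneq T (Lambda k); first exact: psi_d_Lambda.
apply/eqP; rewrite -leqn0.
have -> : 0 = psi_tree psi (DTree (Leaf k d) [::]).
  by rewrite /psi_tree /paths /= big_seq1 /= psi0.
apply: psi_d_le => //; split=> //.
- by apply/fsubsetP => f; rewrite !inE.
- move=> r rT; exists ([::], d); first by rewrite inE.
  by rewrite subtable_rowsE !inE /= rT.
- move=> p; rewrite inE => /eqP -> /=; right=> r.
  by rewrite subtable_rowsE !inE /= andbT; apply: Td.
Qed.

Lemma test_nonconstant T D : is_test T D -> ~ constant_decision T -> D <> fset0.
Proof.
move=> [_ testD] Tnc D0; apply: Tnc.
have [/eqP T0|/fset0Pn[p pT]] := boolP (rows T == fset0).
  by exists ord0 => p; rewrite T0 inE.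
exists p.2 => q qT; apply/eqP/negPn/negP => qp.
by have [f] := testD q p qT pT qp; rewrite D0 inE.
Qed.

(** * Tables with a single column *)

Section OneColumn.
Variables (T : table k) (f : attr).
Hypothesis colsT : cols T = [:: f].

Lemma one_col_attrs : attrs T = [fset f]%fset.
Proof. by apply/fsetP => g; rewrite !inE colsT inE. Qed.

Lemma one_col_neq_Lambda : T <> Lambda k.
Proof. by move/eqP; rewrite -cols_nil colsT. Qed.

Lemma one_col_W psi : W psi T = psi_set psi [fset f]%fset.
Proof. by rewrite /W -cols_nil colsT one_col_attrs. Qed.

Lemma one_col_row p : p \in rows T -> exists a, p.1 = [:: a].
Proof.
move=> /rows_size; rewrite colsT; case: (p.1) => [//|a [|//] _]; by exists a.
Qed.

Lemma mem_one_col_subtable p a : (p \in rows (subtable T [:: (f, a)])) =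
  (p \in rows T) && (p.1 == [:: a]).
Proof.
rewrite subtable_rowsE !inE /= andbT; case pT: (p \in rows T) => //=.
have [b ->] := one_col_row pT.
by rewrite /value colsT /= eqxx /= eqseq_cons andbT.
Qed.

(** One query of [f], followed by a leaf for each possible value, determines the row and so its
    decision. *)
Lemma one_col_psi_d_le psi : psi_d psi T <= psi [:: f].
Proof.
have TN := one_col_neq_Lambda.
have [p0 p0T] : exists p, p \in rows T by apply/fset0Pn; rewrite rows_nil; apply/eqP.
(* An entry of a row shows that ['I_k] is inhabited, which supplies the mandatory first edge of the
   query node. *)
have [a0 _] := one_col_row p0T.
have [b [es enumE]] : exists b es, enum 'I_k = b :: es.
  by have := mem_enum 'I_k a0; case: (enum _) => // b es _; exists b, es.
pose leaf a := Leaf k (decision T [:: a]).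
pose G := DTree (Query f b (leaf b) [seq (a, leaf a) | a <- es]) [::].
have pathsE : paths G = [seq ([:: (f, a)], decision T [:: a]) | a <- enum 'I_k].
  rewrite /paths /= cats0 enumE /=; congr cons.
  by rewrite -map_comp; elim: es {enumE G} => //= a es ->.
have -> : psi [:: f] = psi_tree psi G.
  (* Every path carries the same word [[:: f]], so the maximum is the value on the first one. *)
  rewrite /psi_tree pathsE big_map enumE; apply/eqP; rewrite eqn_leq.
  rewrite big_cons /= leq_max leqnn /= geq_max leqnn /=.
  by apply/bigmax_leqP_seq => a _ _.
apply: psi_d_le => //; split.
- split=> //=; rewrite -map_comp map_id -cons_uniq -enumE enum_uniq /=.
  by rewrite all_map; apply/allP.
- apply/fsubsetP => g; rewrite one_col_attrs !inE /= -map_comp.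
  by case/or3P=> [|/flatten_mapP[]|].
- move=> p pT; have [a pa] := one_col_row pT.
  exists ([:: (f, a)], decision T [:: a]).
    by rewrite pathsE; apply/mapP; exists a; rewrite ?mem_enum.
  by rewrite mem_one_col_subtable pT pa eqxx.
- move=> q; rewrite pathsE => /mapP[a _ ->] /=; right=> p.
  by rewrite mem_one_col_subtable => /andP[/decisionE <- /eqP ->].
Qed.

Variable e : nat -> nat.

(** A lone leaf would make the decisions constant, so the tree starts with a query; its attribute
    can only be [f], and every path pays for it. *)
Lemma one_col_psi_d_ge : ~ constant_decision T -> e f <= psi_d (weight e) T.
Proof.
move=> Tnc; have [[G [[oc _] aG cover good] <-] _] := psi_dP (weight e) one_col_neq_Lambda.
case: G oc aG cover good => v [|//] _ aG cover good.
have [p0 p0T] : exists p, p \in rows T.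
  by apply/fset0Pn; rewrite rows_nil; apply/eqP/one_col_neq_Lambda.
case: v aG cover good => [d|g a v es] aG cover good.
  case: Tnc; exists d => p pT.
  have := good ([::], d); rewrite inE eqxx => /(_ isT) /=.
  (* The empty path selects all of [T], which rules out the alternative [Lambda]. *)
  have pS : p \in rows (subtable T [::]) by rewrite subtable_rowsE !inE /= pT.
  case=> [S0|]; last exact.
  by move: pS; rewrite S0; have /eqP -> : rows (Lambda k) == fset0 by rewrite rows_nil.
have gf : g = f.
  by have /fsubsetP/(_ g) := aG; rewrite one_col_attrs !inE eqxx => /(_ isT)/eqP.
have [p pG _] := cover p0 p0T.
apply: (@leq_trans (weight e [seq fd.1 | fd <- p.1])); last first.
  by rewrite /psi_tree (big_rem p) //= leq_maxl.
apply: weight_ge_mem; move: pG; rewrite /paths /= cats0 mem_cat gf.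
case/orP => [/mapP[q _ ->]|]; first by rewrite inE eqxx.
elim: es {aG cover good} => //= x es IH; rewrite mem_cat.
by case/orP => [/mapP[q _ ->]|//]; rewrite inE eqxx.
Qed.

(** A test of a nonconstant table is nonempty, and here [f] is its only possible element. *)
Lemma one_col_Theta_ge : ~ constant_decision T -> e f <= Theta (weight e) T.
Proof.
move=> Tnc; have [[D testD <-] _] := ThetaP (weight e) one_col_neq_Lambda.
have /eqP/fset0Pn[g gD] := test_nonconstant testD Tnc.
have [/fsubsetP/(_ g gD)] := testD; rewrite one_col_attrs inE => /eqP gf _.
by apply: weight_ge_mem; rewrite -gf.
Qed.

End OneColumn.

(** With [2 <= k] the values 0 and 1 are both available; they form two rows with different
    decisions. *)
Lemma one_col_exists f : 2 <= k -> exists2 T, cols T = [:: f] & ~ constant_decision T.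
Proof.
move=> k2; pose a := Ordinal (ltnW k2); pose b := Ordinal k2.
pose p : seq 'I_k * 'I_2 := ([:: a], ord0); pose q : seq 'I_k * 'I_2 := ([:: b], ord_max).
have [//|//|||rE cE] := @mk_table_rowsE k [:: f] [fset p; q]%fset.
- by move=> x y; rewrite !inE => /orP[]/eqP -> /orP[]/eqP -> //=.
- by move=> x; rewrite !inE => /orP[]/eqP ->.
exists (mk_table [:: f] [fset p; q]%fset).
  by apply: cE; apply/fset0Pn; exists p; rewrite !inE eqxx.
case=> d; rewrite rE => H.
have := H p; have := H q; rewrite !inE !eqxx orbT /= => <- // /(_ isT).
by move/(congr1 val).
Qed.

End Tables.

Theorem theorem3 (k : nat) (hk : (2 <= k)%N) (D : set nat)
    (D_inf : infinite_set D) (D_0 : ~ D 0%N) :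
  exists (psi : seq attr -> nat) (A : set (table k)),
    [/\ complexity_measure psi, bounded psi, closed_class A &
        forall n : nat, FW_is psi A n (Hstep D n) /\ FTheta_is psi A n (Hstep D n)].
Proof.
have [e [e_inc eD]] := increasing_enum_exists D_inf.
have e_gt0 i : 0 < e i.
  by rewrite lt0n; apply/eqP => ei0; apply: D_0; rewrite -eD; exists i.
exists (weight e), [set T : table k | size (cols T) <= 1]%classic; split.
- exact: weight_complexity.
- exact: weight_bounded.
- exact: narrow_closed_class.
move=> n; have [Hlow Hstep_e] := Hstep_spec (conj e_inc eD).
(* Below [e 0] the witness is [Lambda]; otherwise it is a nonconstant table with the single column
   [i], where [e i] is the largest element of [D] not exceeding [n]. *)
have attained : exists T : table k,
    [/\ size (cols T) <= 1, W (weight e) T <= n & psi_d (weight e) T = Hstep D n].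
  have [n0|/(homo_ltn_bracket e_inc)[i ei]] := ltnP n (e 0).
    exists (Lambda k); rewrite psi_d_Lambda Hlow // /W eqxx cols_Lambda.
  have [T Ti Tnc] := one_col_exists i hk.
  exists T; rewrite (one_col_W Ti) psi_set_weight1 (Hstep_e _ _ ei) Ti.
  split=> //; first by case/andP: ei.
  apply/eqP; rewrite eqn_leq (one_col_psi_d_ge Ti) // andbT.
  by rewrite (leq_trans (one_col_psi_d_le Ti _)) // /weight big_seq1.
(* A nonzero depth equals some [e i], which [Theta] also reaches; thus [e i <= n], and [Hstep D n]
   is at least [e i]. *)
have upper (T : table k) : size (cols T) <= 1 ->
    Theta (weight e) T <= n -> psi_d (weight e) T <= Hstep D n.
  move=> T1 Tn; have [Tc|Tnc] := pselect (constant_decision T).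
    by rewrite psi_d_constant // /weight big_nil.
  case Ti: (cols T) T1 => [|i [|//]] _.
    by move/eqP: Ti; rewrite cols_nil => /eqP ->; rewrite psi_d_Lambda.
  apply: (@leq_trans (e i)).
    by rewrite (leq_trans (one_col_psi_d_le Ti _)) // /weight big_seq1.
  by apply: Hstep_ge => //; apply: leq_trans Tn; apply: one_col_Theta_ge.
have [T [T1 TW Te]] := attained; split; split.
- by exists T.
- move=> _ [S [S1 SW] <-]; apply: upper => //; exact: leq_trans (Theta_le_W _ _) SW.
- exists T => //; split=> //; exact: leq_trans (Theta_le_W _ _) TW.
- by move=> _ [S [S1 ST] <-]; apply: upper.
Qed.
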